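(* There is an absolute constant $c>0$ such that for every $\epsilon\in(0,1]$, on every instance of the unsplittable flow with repetitions problem with $B\ge c\,\frac{\ln m}{\epsilon^2}$, algorithm Bounded-UFP-Repeat$(\epsilon/6)$ returns a feasible solution of value at least $\frac{1}{1+\epsilon}$ times the optimum, and its running time is polynomial in $m$ and $\frac{\max_e c_e}{\min_r d_r}$.
   Context: Unsplittable flow with repetitions problem: the input is a directed or undirected graph $G=(V,E)$ with $m=|E|$, a positive capacity $c_e$ for each edge, and a set $\mathcal{R}$ of requests $r=(s_r,t_r,d_r,v_r)$ with source, target, demand $d_r\in(0,1]$ and value $v_r>0$. A feasible solution is a multiset of pairs (request $r$, $s_r$–$t_r$ path), i.e. each request may be satisfied any number of times along possibly different paths, such that for every edge $e$ the total demand over all pairs whose path contains $e$ is at most $c_e$; its value is the sum of $v_r$ over all pairs in the multiset. $B=\min_e c_e$. Algorithm Bounded-UFP-Repeat$(\epsilon)$: set $\mathcal{W}$ to the empty multiset and $y_e=1/c_e$ for all $e$. While $\sum_{e\in E}c_e y_e\le e^{\epsilon(B-1)}$: for every $r\in\mathcal{R}$ let $p_r$ be a shortest $s_r$–$t_r$ path w.r.t. edge weights $y_e$, $|p_r|=\sum_{e\in p_r}y_e$; let $\hat r$ minimize $\frac{d_r}{v_r}|p_r|$ over $r\in\mathcal{R}$; for all $e\in p_{\hat r}$ set $y_e\leftarrow y_e\cdot e^{\epsilon B d_{\hat r}/c_e}$; add $(\hat r,p_{\hat r})$ to $\mathcal{W}$. Output $\mathcal{W}$.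
   Formalization: The formal claim assumes m ≥ 2 (for m = 1 the bound on B is void and the ratio fails), s_r ≠ t_r (else the optimum is infinite), and its running time bound is (|R|+1) times a polynomial in m and max c/min d, since every iteration inspects all requests. *)

(* Defs.v *)
From HB Require Import structures.
From mathcomp Require Import all_boot all_order all_algebra.
From mathcomp Require Import all_classical all_reals all_analysis.

Set Implicit Arguments.
Unset Strict Implicit.
Unset Printing Implicit Defensive.

Import Order.TTheory GRing.Theory Num.Theory.

Local Open Scope ring_scope.
Local Open Scope classical_set_scope.

(* In an undirected instance the orientation esrc/edst of an edge is only a way
   of naming its two ends. Parallel edges are allowed; a simple graph is the
   case where distinct edges have distinct ends. Requests are an indexed family,
   so that two of them may carry the same data. The condition rsrc_neq_rtgt
   excludes the empty path, along which a request could be satisfied infinitely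
   often. A request need not be routable. *)
Record instance (R : realType) := Instance {
  vertex : finType;
  edge : finType;
  request : finType;
  directed : bool;
  esrc : edge -> vertex;
  edst : edge -> vertex;
  cap : edge -> R;
  rsrc : request -> vertex;
  rtgt : request -> vertex;
  dem : request -> R;
  worth : request -> R;
  cap_gt0 : forall e, 0 < cap e;
  dem_gt0 : forall r, 0 < dem r;
  dem_le1 : forall r, dem r <= 1;
  worth_gt0 : forall r, 0 < worth r;
  rsrc_neq_rtgt : forall r, rsrc r != rtgt r
}.

Section Problem.
Variables (R : realType) (I : instance R).
Local Notation V := (vertex I).
Local Notation E := (edge I).
Local Notation Req := (request I).

Definition joins (e : E) (u v : V) : bool :=
  (esrc e == u) && (edst e == v) ||
  ~~ directed I && (esrc e == v) && (edst e == u).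

(* The edges p lead from u successively through the vertices vs. *)
Fixpoint walk (u : V) (p : seq E) (vs : seq V) : bool :=
  match p, vs with
  | [::], [::] => true
  | e :: p', v :: vs' => joins e u v && walk v p' vs'
  | _, _ => false
  end.

(* A path is given by its sequence of edges, and visits no vertex twice. *)
Definition is_path (s t : V) (p : seq E) : Prop :=
  exists vs : seq V, [/\ walk s p vs, last s vs = t & uniq (s :: vs)].

Definition req_path (r : Req) (p : seq E) : Prop := is_path (rsrc r) (rtgt r) p.

(* Multisets of (request, path) pairs are represented by sequences; all the
   notions below are invariant under permutation. *)
Definition load (W : seq (Req * seq E)) (e : E) : R :=
  \sum_(x <- W | e \in x.2) dem x.1.

Definition feasible (W : seq (Req * seq E)) : Prop :=
  (forall x, x \in W -> req_path x.1 x.2) /\ (forall e, load W e <= cap e).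

Definition total_value (W : seq (Req * seq E)) : R := \sum_(x <- W) worth x.1.

(* Over nonempty finite index types these inf and sup are min and max. *)
Definition min_cap : R := inf (range (@cap R I)).
Definition max_cap : R := sup (range (@cap R I)).
Definition min_dem : R := inf (range (@dem R I)).

Definition plen (y : {ffun E -> R}) (p : seq E) : R := \sum_(e <- p) y e.

Definition shortest (y : {ffun E -> R}) (r : Req) (p : seq E) : Prop :=
  req_path r p /\ forall q, req_path r q -> plen y p <= plen y q.

(* Requests without any path are ignored (their distance is infinite). *)
Definition selected (y : {ffun E -> R}) (r : Req) (p : seq E) : Prop :=
  shortest y r p /\
  forall r' p', shortest y r' p' ->
    dem r / worth r * plen y p <= dem r' / worth r' * plen y p'.

Definition guard (eps : R) (y : {ffun E -> R}) : Prop :=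
  \sum_e cap e * y e <= expR (eps * (min_cap - 1)).

Definition init_weight : {ffun E -> R} := [ffun e => (cap e)^-1].

Definition update (eps : R) (y : {ffun E -> R}) (r : Req) (p : seq E) :
    {ffun E -> R} :=
  [ffun e => if e \in p then y e * expR (eps * min_cap * dem r / cap e)
             else y e].

(* The states (W, y) at the entry of the loop, with arbitrary tie-breaking among
   shortest paths and among minimizing requests; size W is the number of
   iterations performed so far. *)
Inductive reaches (eps : R) : seq (Req * seq E) -> {ffun E -> R} -> Prop :=
| reaches_init : reaches eps [::] init_weight
| reaches_step W y r p :
    reaches eps W y -> guard eps y -> selected y r p ->
    reaches eps ((r, p) :: W) (update eps y r p).

(* If no request is routable the choice of a minimizing request is impossible,
   and the algorithm stops. *)
Definition outputs (eps : R) (W : seq (Req * seq E)) : Prop :=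
  exists y, reaches eps W y /\
    (~ guard eps y \/ ~ exists r p, req_path r p).

End Problem.

(* Cost model (unit-cost real RAM) for an implementation of the algorithm: a
   computation is its result together with its number of steps. Each
   arithmetic operation on reals (including exp), comparison, equality test,
   array access and inspection or creation of one list cell is a step; the
   handling of booleans, pairs and options is not counted, being bounded by a
   constant per step. *)
Definition timed (A : Type) := (A * nat)%type.

Definition op (A : Type) (a : A) : timed A := (a, 1%N).

Definition bind (A B : Type) (x : timed A) (f : A -> timed B) : timed B :=
  ((f x.1).1, (x.2 + (f x.1).2)%N).

Notation "'let!' a := x 'in' b" := (bind x (fun a => b))
  (at level 200, a name, x at level 100, b at level 200).

Definition tick (A : Type) (x : timed A) : timed A := (x.1, x.2.+1).

Fixpoint tfold (A S : Type) (f : S -> A -> timed S) (s : S) (l : seq A) :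
    timed S :=
  tick match l with
       | [::] => op s
       | a :: l' => let! s' := f s a in tfold f s' l'
       end.

Section Implementation.
Variables (R : realType) (I : instance R).
Local Notation V := (vertex I).
Local Notation E := (edge I).
Local Notation Req := (request I).

Definition write (y : {ffun E -> R}) (e : E) (x : R) : {ffun E -> R} :=
  [ffun f => if f == e then x else y f].

(* A label (v, (d, p)) records a walk of length d to v whose list of edges is p
   in reverse order. Tables of labels are association lists, so that the cost
   does not depend on the number of isolated vertices. *)
Definition label := (R * seq E)%type.

Fixpoint tlookup (v : V) (L : seq (V * label)) : timed (option label) :=
  tick match L with
       | [::] => op None
       | (w, a) :: L' =>
           let! b := op (w == v) in
           if b then op (Some a) else tlookup v L'
       end.

Fixpoint tstore (v : V) (a : label) (L : seq (V * label)) :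
    timed (seq (V * label)) :=
  tick match L with
       | [::] => op [:: (v, a)]
       | (w, b) :: L' =>
           let! c := op (w == v) in
           if c then op ((v, a) :: L')
           else let! L'' := tstore v a L' in op ((w, b) :: L'')
       end.

Definition trelax (y : {ffun E -> R}) (e : E) (u v : V) (L : seq (V * label)) :
    timed (seq (V * label)) :=
  let! lu := tlookup u L in
  match lu with
  | None => op L
  | Some (d, p) =>
      let! ye := op (y e) in
      let! d' := op (d + ye) in
      let! p' := op (e :: p) in
      let! lv := tlookup v L in
      match lv with
      | None => tstore v (d', p') L
      | Some (dv, _) =>
          let! b := op (d' < dv) in
          if b then tstore v (d', p') L else op L
      end
  end.

Definition trelax_edge (y : {ffun E -> R}) (L : seq (V * label)) (e : E) :
    timed (seq (V * label)) :=
  let! u := op (esrc e) in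
  let! v := op (edst e) in
  let! L' := trelax y e u v L in
  let! b := op (directed I) in
  if b then op L' else trelax y e v u L'.

(* Bellman-Ford from s; #|E| rounds suffice, since a path has at most #|E|
   edges. *)
Definition tbellman_ford (y : {ffun E -> R}) (s : V) :
    timed (seq (V * label)) :=
  let! L0 := op [:: (s, (0, [::]))] in
  tfold (fun (L : seq (V * label)) (_ : E) => tfold (trelax_edge y) L (enum E))
    L0 (enum E).

(* The best request so far, its key d_r / v_r * |p_r| and its reversed path. *)
Definition tselect (y : {ffun E -> R}) : timed (option (Req * R * seq E)) :=
  tfold (fun (best : option (Req * R * seq E)) (r : Req) =>
    let! L := tbellman_ford y (rsrc r) in
    let! l := tlookup (rtgt r) L in
    match l with
    | None => op best
    | Some (d, p) =>
        let! x := op (dem r / worth r) in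
        let! k := op (x * d) in
        match best with
        | None => op (Some (r, k, p))
        | Some (_, k', _) =>
            let! b := op (k < k') in
            if b then op (Some (r, k, p)) else op best
        end
    end) None (enum Req).

Definition tupdate (eps B : R) (y : {ffun E -> R}) (r : Req) (p : seq E) :
    timed {ffun E -> R} :=
  tfold (fun (y' : {ffun E -> R}) (e : E) =>
    let! x1 := op (eps * B) in
    let! x2 := op (x1 * dem r) in
    let! x3 := op (x2 / cap e) in
    let! x4 := op (expR x3) in
    let! ye := op (y' e) in
    let! x5 := op (ye * x4) in
    op (write y' e x5)) y p.

Definition trev (p : seq E) : timed (seq E) :=
  tfold (fun (q : seq E) (e : E) => op (e :: q)) [::] p.

Definition tsum (y : {ffun E -> R}) : timed R :=
  tfold (fun (s : R) (e : E) =>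
    let! x1 := op (y e) in
    let! x2 := op (cap e * x1) in
    op (s + x2)) 0 (enum E).

Definition tmin_cap : timed R :=
  let! b := tfold (fun (best : option R) (e : E) =>
    match best with
    | None => op (Some (cap e))
    | Some x =>
        let! b := op (cap e < x) in
        if b then op (Some (cap e)) else op best
    end) None (enum E) in
  op (odflt 0 b).

Definition tinit : timed {ffun E -> R} :=
  tfold (fun (y : {ffun E -> R}) (e : E) =>
      let! x := op ((cap e)^-1) in op (write y e x))
    [ffun=> 0] (enum E).

Definition state := (seq (Req * seq E) * {ffun E -> R})%type.

(* One test of the loop condition, followed by one iteration if it succeeds;
   None means that the loop is left. *)
Definition tbody (eps B : R) (st : state) : timed (option state) :=
  let! D := tsum st.2 in
  let! x1 := op (B - 1) in
  let! x2 := op (eps * x1) in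
  let! x3 := op (expR x2) in
  let! b := op (D <= x3) in
  if b then
    let! best := tselect st.2 in
    match best with
    | None => op None
    | Some (r, _, p) =>
        let! y := tupdate eps B st.2 r p in
        let! q := trev p in
        op (Some ((r, q) :: st.1, y))
    end
  else op None.

Inductive loop (eps B : R) : state -> nat -> state -> Prop :=
| loop_exit st n :
    tbody eps B st = (None, n) -> loop eps B st n st
| loop_next st st' st'' n n' :
    tbody eps B st = (Some st', n) -> loop eps B st' n' st'' ->
    loop eps B st (n + n')%N st''.

(* The implementation halts after T steps with output W. *)
Definition executes (eps : R) (T : nat) (W : seq (Req * seq E)) : Prop :=
  exists T' y,
    loop eps tmin_cap.1 ([::], tinit.1) T' (W, y) /\
    T = (tmin_cap.2 + tinit.2 + T')%N.

End Implementation.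

Definition eval2 (R : realType) (P : {poly {poly R}}) (x y : R) : R :=
  (P.[x%:P]).[y].

(* Main.v *)
Require Import Defs.
From mathcomp Require Import all_boot all_order all_algebra.
From mathcomp Require Import all_classical all_reals all_analysis.
From mathcomp Require Import zify ring lra.
Import Order.TTheory GRing.Theory Num.Theory.
Local Open Scope ring_scope.

Set Implicit Arguments.
Unset Strict Implicit.
Unset Printing Implicit Defensive.

(* Write d = eps / 6, D = sum_e c_e y_e, and let V be the value of a feasible
   solution. Invariantly y_e = exp(d B load_e / c_e) / c_e, so the guard leaves
   room for one more demand on every edge, and the output is feasible; its total
   load is at most m max c, which bounds the number of iterations. By weak
   duality the selected request has d_r |p_r| <= v_r D / V, so an iteration
   multiplies D by at most exp(d / (1 - d) B v_r / V). As D starts from m and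
   finally exceeds exp(d (B - 1)), the value of the output is at least
   V (1 - d) (1 - 1 / B - ln m / (d B)), and B >= 36 ln m / eps^2 makes this at
   least V / (1 + eps).
   The label lengths of Bellman-Ford are lengths of actual walks that are at
   most those of all simple paths; as weights are positive, a shortest walk is
   simple. *)

(** * Walks and simple paths *)

Section Walks.
Context {R : realType} {I : instance R}.
Implicit Types (u v s t : vertex I) (e : edge I) (p q : seq (edge I)).
Implicit Types (vs ws : seq (vertex I)).

Lemma walk_rcons u p vs e v :
  walk u (rcons p e) (rcons vs v) = walk u p vs && joins e (last u vs) v.
Proof.
elim: p u vs => [|f p IH] u [|w vs] //=.
- by rewrite andbT.
- by case: vs => *; rewrite andbF.
- by case: p {IH} => *; rewrite andbF.
- by rewrite IH andbA.
Qed.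

Lemma walk_ends u p vs e : walk u p vs -> e \in p ->
  (esrc e \in u :: vs) && (edst e \in u :: vs).
Proof.
elim: p u vs => [|f p IH] u [|v vs] //= /andP[j wp].
rewrite in_cons => /predU1P[->|/(IH _ _ wp)].
  move: j; rewrite /joins => /orP[/andP[/eqP-> /eqP->]|/andP[/andP[_ /eqP->] /eqP->]];
  by rewrite !in_cons !eqxx !orbT.
by move=> /andP[a b]; rewrite ![_ \in u :: _]in_cons a b !orbT.
Qed.

(** If the first edge recurred, both its ends, and so the start [u], would be among the later
    vertices. *)
Lemma walk_uniq_edges u p vs : walk u p vs -> uniq (u :: vs) -> uniq p.
Proof.
elim: p u vs => [|e p IH] u [|v vs] // /andP[j wp] /andP[nu uv].
rewrite cons_uniq (IH _ _ wp uv) andbT; apply/negP => /(walk_ends wp) /andP[es ed].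
by move: j nu; rewrite /joins => /orP[/andP[/eqP<- _]|/andP[_ /eqP<-]];
   rewrite ?es ?ed.
Qed.

Lemma req_path_uniq r p : req_path (I := I) r p -> uniq p.
Proof. by case=> vs [wp _ uvs]; exact: walk_uniq_edges wp uvs. Qed.

Lemma req_path_size r p : req_path (I := I) r p -> (size p <= #|edge I|)%N.
Proof. by move=> /req_path_uniq /card_uniqP <-; exact: max_card. Qed.

(** The empty walk ends where it starts. Hence every routed pair loads some edge, which is what
    bounds the number of iterations. *)
Lemma req_path_neq0 r p : req_path (I := I) r p -> p != [::].
Proof.
case=> vs [wp lp _]; apply/eqP => p0; move: wp lp; rewrite p0.
by case: vs => //= _ st; have := rsrc_neq_rtgt r; rewrite st eqxx.
Qed.

Section Weights.
Variable y : {ffun edge I -> R}.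
Hypothesis y_gt0 : forall e, 0 < y e.

Lemma plen_cons e p : plen y (e :: p) = y e + plen y p.
Proof. by rewrite /plen big_cons. Qed.

Lemma plen_rcons e p : plen y (rcons p e) = plen y p + y e.
Proof. by rewrite /plen big_rcons /= addrC. Qed.

Lemma plen_rev p : plen y (rev p) = plen y p.
Proof. by rewrite /plen; apply: perm_big; rewrite perm_rev. Qed.

Lemma walk_suffix u p vs v : walk u p vs -> v \in u :: vs ->
  exists q ws, [/\ walk v q ws, last v ws = last u vs,
    uniq (u :: vs) -> uniq (v :: ws) & plen y q <= plen y p].
Proof.
elim: p u vs => [|e p IH] u [|w vs] //.
  by move=> _; rewrite inE => /eqP->; exists [::], [::].
move=> wk; rewrite in_cons => /predU1P[->|]; first by exists (e :: p), (w :: vs).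
move: wk => /= /andP[_ wp] /(IH _ _ wp) [q [ws [wq lq uq le_q]]].
exists q, ws; split=> //; first by move=> /andP[_ /uq].
by rewrite plen_cons (le_trans le_q)// lerDr ltW.
Qed.

(* A repeated vertex closes a cycle, whose removal strictly shortens the walk. *)
Lemma walk_shorten u p vs : walk u p vs ->
  exists q ws, [/\ walk u q ws, last u ws = last u vs, uniq (u :: ws)
    & (q = p) * (ws = vs) \/ plen y q < plen y p].
Proof.
elim: p u vs => [|e p IH] u [|v vs] //.
  by move=> _; exists [::], [::]; split=> //; left.
move=> /= /andP[j /IH [q [ws [wq lq uq short]]]].
(* If the shortened tail returns to [u], its part from [u] on replaces the whole walk; dropping [e]
   makes the gain strict. *)
have [u_in|u_out] := boolP (u \in v :: ws).
  have [q' [ws' [wq' lq' uq' le_q']]] := walk_suffix wq u_in.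
  exists q', ws'; split=> //; [by rewrite lq' | exact: uq' |].
  right; rewrite plen_cons (le_lt_trans le_q')//.
  by case: short => [[-> _]|/lt_trans->//]; rewrite ltrDr.
exists (e :: q), (v :: ws); split=> //=; [by rewrite j | by apply/andP |].
by case: short => [[-> ->]|lt_q]; [left | right; rewrite !plen_cons ltrD2l].
Qed.

End Weights.
End Walks.

(** * Bellman-Ford *)

Section TimedFold.
Context {A S : Type}.
Implicit Types (f : S -> A -> timed S) (s : S) (a : A) (l : seq A).

Lemma tfold_foldl f s l :
  (tfold f s l).1 = foldl (fun s a => (f s a).1) s l.
Proof. by elim: l s => //= a l IH s; rewrite IH. Qed.

Lemma tfold_ind f (P : seq A -> S -> Prop) s :
  P [::] s -> (forall l s' a, P l s' -> P (rcons l a) (f s' a).1) ->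
  forall l, P l (tfold f s l).1.
Proof.
move=> P0 PS l; rewrite tfold_foldl.
by elim/last_ind: l => [|l a IH] //; rewrite foldl_rcons; exact: PS.
Qed.

(** Here [mu] measures the state and grows by at most [g] per element, so it stays below [M] and the
    bound [c] applies throughout. Each element pays one more step for its list cell, and the end of
    the list costs 2. *)
Lemma tfold_cost f (mu : S -> nat) (g c M : nat) :
  (forall s a, mu (f s a).1 <= mu s + g)%N ->
  (forall s a, mu s <= M -> (f s a).2 <= c)%N ->
  forall l s, (mu s + g * size l <= M)%N ->
  ((tfold f s l).2 <= size l * c.+1 + 2)%N.
Proof.
move=> grow cost; elim=> [|a l IH] s /= leM; first by [].
have := cost s a; have := grow s a; have := IH (f s a).1.
move: (tfold _ _ _).2 (mu _) (f s a).2 => x z t IHx gz ct.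
have : (x <= size l * c.+1 + 2)%N by apply: IHx; lia.
have : (t <= c)%N by apply: ct; lia.
lia.
Qed.

Lemma tfold_size f (mu : S -> nat) g :
  (forall s a, mu (f s a).1 <= mu s + g)%N ->
  forall l s, (mu (tfold f s l).1 <= mu s + g * size l)%N.
Proof.
move=> grow l s.
elim/tfold_ind: l / (tfold f s l).1; first by lia.
move=> l s' a; rewrite size_rcons; have := grow s' a; lia.
Qed.

End TimedFold.

Section BellmanFord.
Context {R : realType} {I : instance R}.
Implicit Types (u v s : vertex I) (e : edge I) (p q : seq (edge I)).
Implicit Types (L : seq (vertex I * label I)) (a : label I).
Variable y : {ffun edge I -> R}.

Let table_ind := @tfold_ind (edge I) (seq (vertex I * label I)).

Lemma tlookup_tstore v w a L :
  (tlookup w (tstore v a L).1).1 = if v == w then Some a else (tlookup w L).1.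
Proof.
elim: L => [|[x b] L IH] /=; first by case: eqP.
have [->|xv] /= := eqVneq x v; first by case: eqP.
have [<-|_] //= := eqVneq x w; by rewrite eq_sym (negbTE xv).
Qed.

(** An upper bound instead of the exact label: relaxation only improves labels, so this is never
    lost. *)
Definition reached L v (x : R) : Prop :=
  exists a, (tlookup v L).1 = Some a /\ a.1 <= x.

Lemma trelax_reached e u v L (L' := (trelax y e u v L).1) :
  (forall w x, reached L w x -> reached L' w x) /\
  (forall x, reached L u x -> reached L' v (x + y e)).
Proof.
(* Overwriting the label of [v] is harmless if the new label is no longer than the old one. *)
have store dp : (forall b, (tlookup v L).1 = Some b -> dp.1 <= b.1) ->
    forall w x, reached L w x -> reached (tstore v dp L).1 w x.
  move=> le_b w x [b [lb bx]]; rewrite /reached tlookup_tstore.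
  have [vw|_] := eqVneq; last by exists b.
  by exists dp; split=> //; apply: le_trans bx; apply: le_b; rewrite vw.
rewrite /L' /trelax /bind /=.
case lu: (tlookup u L).1 => [[d p]|] /=; last first.
  by split=> // x [a []]; rewrite lu.
case lv: (tlookup v L).1 => [[dv pv]|] /=.
  case: ltP => d_dv /=; split.
  - by apply: store => b; rewrite lv => -[<-]; exact: ltW.
  - move=> x [a []]; rewrite lu => -[<-] /= dx.
    by exists (d + y e, e :: p); rewrite tlookup_tstore eqxx lerD2r.
  - by [].
  - move=> x [a []]; rewrite lu => -[<-] /= dx.
    exists (dv, pv); split=> //=.
    by rewrite (le_trans d_dv)// lerD2r.
split; first by apply: store => b; rewrite lv.
move=> x [a []]; rewrite lu => -[<-] /= dx.
by exists (d + y e, e :: p); rewrite tlookup_tstore eqxx lerD2r.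
Qed.

Lemma trelax_edge_reached e L (L' := (trelax_edge y L e).1) :
  (forall w x, reached L w x -> reached L' w x) /\
  (forall u v x, joins e u v -> reached L u x -> reached L' v (x + y e)).
Proof.
rewrite /L' /trelax_edge /bind /joins /=.
have [m1 r1] := trelax_reached e (esrc e) (edst e) L.
have [m2 r2] :=
  trelax_reached e (edst e) (esrc e) (trelax y e (esrc e) (edst e) L).1.
case: (directed I) => /=.
  by split=> // u v x /orP[/andP[/eqP<- /eqP<-]|//]; exact: r1.
(* Undirected case: the second relaxation keeps what the first achieved, and the first keeps the
   premise of the second. *)
split; first by move=> w x /m1/m2.
move=> u v x /orP[/andP[/eqP<- /eqP<-]|/andP[/eqP<- /eqP<-]].
  by move=> /r1/m2.
by move=> /m1/r2.
Qed.

Definition relax_round L := tfold (trelax_edge y) L (enum (edge I)).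

Lemma relax_round_reached L (L' := (relax_round L).1) :
  (forall w x, reached L w x -> reached L' w x) /\
  (forall e u v x, joins e u v -> reached L u x -> reached L' v (x + y e)).
Proof.
(* Restricted to the edges scanned so far, the second claim becomes an invariant of the fold. *)
suff [H1 H2] : (forall w x, reached L w x -> reached L' w x) /\
    (forall e u v x, e \in enum (edge I) ->
       joins e u v -> reached L u x -> reached L' v (x + y e)).
  by split=> // e u v x; apply: H2; rewrite mem_enum.
rewrite /L' /relax_round; elim/table_ind: (enum _) / (tfold _ _ _).1.
  by split.
move=> l L1 e [m1 r1]; have [m2 r2] := trelax_edge_reached e L1.
split=> [w x /m1/m2//|f u v x].
rewrite mem_rcons in_cons => /predU1P[->|fl] j Lu; first by apply: r2 (m1 _ _ Lu).
by apply: m2; apply: r1 Lu.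
Qed.

(** After k rounds the bound holds for walks of at most k edges: one more round carries it across
    the last edge. *)
Lemma tbellman_ford_reached s p vs : walk s p vs ->
  (size p <= #|edge I|)%N ->
  reached (tbellman_ford y s).1 (last s vs) (plen y p).
Proof.
(* With the bound written as the size of [enum], the fold induction replaces it by the number of
   rounds done. *)
rewrite [#|_|]cardE /tbellman_ford /bind /= -/relax_round.
elim/table_ind: (enum _) / (tfold _ _ _).1 p vs.
  move=> [|//] [|//] _ _; exists (0, [::]).
  by rewrite /= eqxx /plen big_nil lexx.
move=> l L f /= IH p vs; have [mono relaxed] := relax_round_reached L.
rewrite size_rcons leq_eqVlt => wp /orP[|]; last first.
  by rewrite ltnS => pl; apply: mono; exact: IH.
case/lastP: p wp => [//|p e]; case/lastP: vs => [|vs v].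
  by case: p.
rewrite walk_rcons size_rcons last_rcons eqSS => /andP[wp j] /eqP pl.
by rewrite plen_rcons; apply: relaxed j _; apply: IH wp _; rewrite pl.
Qed.

(** Labels store reversed edge lists and are only claimed to be walks; simplicity comes later, from
    positive weights. *)
Definition sound s L := forall v d p, (tlookup v L).1 = Some (d, p) ->
  exists vs, [/\ walk s (rev p) vs, last s vs = v & d = plen y p].

Lemma trelax_sound s e u v L : joins e u v -> sound s L ->
  sound s (trelax y e u v L).1.
Proof.
move=> j sL; rewrite /trelax /bind /=.
case lu: (tlookup u L).1 => [[d p]|] //=.
have store : sound s (tstore v (d + y e, e :: p) L).1.
  move=> w d' p'; rewrite tlookup_tstore; have [<-|_] := eqVneq; last exact: sL.
  move=> [<- <-]; have [vs [wp lp dp]] := sL _ _ _ lu.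
  exists (rcons vs v).
  by rewrite rev_cons walk_rcons wp last_rcons lp j plen_cons -dp addrC.
case: (tlookup v L).1 => [[dv pv]|] //=.
by case: ifP.
Qed.

Lemma tbellman_ford_sound s : sound s (tbellman_ford y s).1.
Proof.
rewrite /tbellman_ford /bind /= -/relax_round.
elim/table_ind: (enum _) / (tfold _ _ _).1.
  move=> v d p /=; have [<- [<- <-]|//] := eqVneq s v.
  by exists [::]; rewrite /plen big_nil.
move=> l0 L f /= sL; rewrite /relax_round.
elim/table_ind: (enum _) / (tfold _ _ _).1 => // l L' e sL'.
rewrite /trelax_edge /bind /=.
case: (boolP (directed I)) => dI /=; first by apply: trelax_sound => //; rewrite /joins !eqxx.
do 2![apply: trelax_sound; first by rewrite /joins dI !eqxx ?orbT].
by [].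
Qed.

Hypothesis y_gt0 : forall e, 0 < y e.

(** The label is at most the length of every simple path. Were its walk not simple, shortening it
    would give a simple path strictly below the label. *)
Lemma tbellman_ford_shortest r d p :
  (tlookup (rtgt r) (tbellman_ford y (rsrc r)).1).1 = Some (d, p) ->
  shortest y r (rev p) /\ d = plen y p.
Proof.
move=> lr; have [vs [wp lp dp]] := tbellman_ford_sound lr.
have minp q : req_path r q -> plen y (rev p) <= plen y q.
  move=> rq; have [ws [wq lq uq]] := rq.
  have [a []] := tbellman_ford_reached wq (req_path_size rq).
  by rewrite lq lr => -[<-] /=; rewrite dp plen_rev.
split=> //; split=> //.
have [q [ws [wq lq uq short]]] := walk_shorten y_gt0 wp.
have rq : req_path r q by exists ws; rewrite lq.
case: short => [[<- _] //|].
by rewrite ltNge minp.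
Qed.

Lemma tbellman_ford_routable r q : req_path r q ->
  exists d p, (tlookup (rtgt r) (tbellman_ford y (rsrc r)).1).1 = Some (d, p).
Proof.
move=> rq; have [ws [wq lq uq]] := rq.
have [[d p] []] := tbellman_ford_reached wq (req_path_size rq).
by rewrite lq => lr _; exists d, p.
Qed.

(** Existence is read off the output of Bellman-Ford. *)
Lemma shortest_exists r q : req_path (I := I) r q -> exists p, shortest y r p.
Proof.
by move=> /tbellman_ford_routable[d [p /tbellman_ford_shortest[sp _]]]; exists (rev p).
Qed.

Lemma tselect_correct :
  match (tselect y).1 with
  | None => ~ exists r p, req_path (I := I) r p
  | Some (r, _, p) => selected y r (rev p)
  end.
Proof.
(* Invariant after scanning [l]: [None] means that no request of [l] is routable; otherwise the
   stored key is minimal over [l]. *)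
pose best (l : seq (request I)) (b : option (request I * R * seq (edge I))) :=
  match b with
  | None => forall r p, r \in l -> ~ req_path (I := I) r p
  | Some (r, k, p) => [/\ shortest y r (rev p),
      k = dem r / worth r * plen y (rev p) &
      forall r' p', r' \in l -> shortest y r' p' ->
        k <= dem r' / worth r' * plen y p']
  end.
suff : best (enum (request I)) (tselect y).1.
  case: (tselect y).1 => [[[r k] p]|] /=.
    by case=> sp -> mink; split=> // r' p'; apply: mink; rewrite mem_enum.
  by move=> H [r [p]]; apply: H; rewrite mem_enum.
rewrite /tselect; elim/(@tfold_ind (request I) (option (request I * R * seq (edge I)))): (enum _) / (tfold _ _ _).1; first by [].
move=> l b r bl; rewrite /bind /=.
case lr: (tlookup _ _).1 => [[d p]|] /=; last first.
  have unroutable q : ~ req_path r q.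
    by move=> /tbellman_ford_routable[d [p]]; rewrite lr.
  case: b bl => [[[r1 k1] p1]|] /=.
    case=> sp -> mink; split=> // r' p'; rewrite mem_rcons in_cons.
    by case/predU1P => [->|]; [case=> /unroutable | exact: mink].
  move=> H r' p'; rewrite mem_rcons in_cons.
  by case/predU1P => [->|]; [exact: unroutable | exact: H].
have [sp dp] := tbellman_ford_shortest lr.
have mine p' : shortest y r p' -> dem r / worth r * d <= dem r / worth r * plen y p'.
  move=> [rp' _]; rewrite ler_wpM2l ?divr_ge0 ?(ltW (dem_gt0 _)) ?(ltW (worth_gt0 _))//.
  by rewrite dp -plen_rev; case: sp => _; apply.
case: b bl => [[[r1 k1] p1]|] /=.
  case=> sp1 k1E mink; case: ltP => kk /=; split=> //.
  - by rewrite dp plen_rev.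
  - move=> r' p'; rewrite mem_rcons in_cons => /predU1P[->|r'l]; first exact: mine.
    by move=> /(mink _ _ r'l); apply: le_trans; exact: ltW.
  - move=> r' p'; rewrite mem_rcons in_cons => /predU1P[->|]; last exact: mink.
    by move=> /mine; exact: le_trans.
move=> H; split=> //; first by rewrite dp plen_rev.
move=> r' p'; rewrite mem_rcons in_cons => /predU1P[->|r'l]; first exact: mine.
by case=> /(H _ _ r'l).
Qed.

End BellmanFord.

(** * Feasibility and approximation *)

Section Extrema.
Context {R : realType} {T : finType}.
Implicit Types (f : T -> R) (i : T).

Lemma has_lbound_range f : has_lbound (range f).
Proof.
exists (- \sum_i `|f i|) => _ [i _ <-].
rewrite lerNl (le_trans (ler_norm _))// normrN (bigD1 i)//= lerDl.
by apply: sumr_ge0 => j _.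
Qed.

Lemma has_ubound_range f : has_ubound (range f).
Proof.
exists (\sum_i `|f i|) => _ [i _ <-].
rewrite (le_trans (ler_norm _))// (bigD1 i)//= lerDl.
by apply: sumr_ge0 => j _.
Qed.

Lemma inf_range_eq f i : (forall j, f i <= f j) -> inf (range f) = f i.
Proof.
move=> mini; apply/eqP; rewrite eq_le; apply/andP; split.
  by apply: ge_inf; [exact: has_lbound_range | exists i].
apply: lb_le_inf; first by exists (f i), i.
by move=> _ [j _ <-].
Qed.

Lemma inf_range_le f i : inf (range f) <= f i.
Proof. by apply: ge_inf; [exact: has_lbound_range | exists i]. Qed.

Lemma inf_range_gt0 f i : (forall j, 0 < f j) -> 0 < inf (range f).
Proof.
move=> f_gt0; case: (@arg_minP _ _ _ i xpredT f) => // j _ minj.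
by rewrite (@inf_range_eq _ j)// => k; exact: minj.
Qed.

Lemma sup_range_ge f i : f i <= sup (range f).
Proof. by apply: ub_le_sup; [exact: has_ubound_range | exists i]. Qed.

End Extrema.

(** * Weights, loads and the dual objective *)

Section Approximation.
Context {R : realType} {I : instance R}.
Local Notation E := (edge I).
Implicit Types (W S : seq (request I * seq E)) (y : {ffun E -> R}).
Implicit Types (e : E) (p q : seq E).
Local Notation B := (min_cap I).

Definition dual y : R := \sum_e cap e * y e.

Lemma min_cap_le e : B <= cap e.
Proof. exact: inf_range_le. Qed.

Lemma min_dem_le (r : request I) : min_dem I <= dem r.
Proof. exact: inf_range_le. Qed.

Lemma load_cons r p W e :
  load ((r, p) :: W) e = (if e \in p then dem r else 0) + load W e.
Proof. by rewrite /load big_cons /=; case: ifP => // _; rewrite add0r. Qed.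

(** Updates multiply the weights, so their exponents add up to the load. *)
Lemma reaches_weight eps W y : reaches eps W y ->
  forall e, y e = (cap e)^-1 * expR (eps * B * load W e / cap e).
Proof.
elim=> {W y} [e|W y r p _ IH _ _ e].
  by rewrite ffunE /load big_nil mulr0 mul0r expR0 mulr1.
rewrite ffunE load_cons; case: ifP => _; last by rewrite add0r IH.
by rewrite IH -[LHS]mulrA -expRD -mulrDl -mulrDr addrC.
Qed.

Lemma reaches_gt0 eps W y : reaches eps W y -> forall e, 0 < y e.
Proof.
by move=> /reaches_weight yE e; rewrite yE mulr_gt0 ?expR_gt0// invr_gt0 cap_gt0.
Qed.

Lemma cap_weight_le_dual eps W y e : reaches eps W y -> cap e * y e <= dual y.
Proof.
move=> Wy; rewrite /dual (bigD1 e)//= lerDl; apply: sumr_ge0 => f _.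
by rewrite mulr_ge0 ?ltW ?cap_gt0 ?(reaches_gt0 Wy).
Qed.

(** The guard bounds the single term [cap e * y e], so [B * load W e <= (B - 1) * cap e]. As
    [B <= cap e], this gives [load W e + 1 <= cap e], enough for any demand. *)
Lemma reaches_feasible eps W y : 0 < eps -> reaches eps W y -> feasible W.
Proof.
move=> eps_gt0; elim=> {W y} [|W y r p Wy [IHp IHc] gy [[rp _] _]].
  by split=> // e; rewrite /load big_nil ltW ?cap_gt0.
split=> [x|e]; first by rewrite in_cons => /predU1P[->|/IHp].
rewrite load_cons; case: ifP => _; last by rewrite add0r.
have B_gt0 : 0 < B by apply: (inf_range_gt0 e) => f; exact: cap_gt0.
have c_gt0 := cap_gt0 e; have Bc := min_cap_le e.
have := le_trans (cap_weight_le_dual e Wy) gy.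
rewrite (reaches_weight Wy) mulVKf ?gt_eqF// ler_expR -!mulrA ler_pM2l//.
rewrite mulrA ler_pdivrMr// => le_load.
have : B * (load W e + 1) <= B * cap e by nra.
rewrite ler_pM2l// => le_cap; rewrite addrC (le_trans _ le_cap)// lerD2l.
exact: dem_le1.
Qed.

(** Sum the loads over all edges: each pair contributes at least the minimal demand, each edge
    receives at most the maximal capacity. *)
Lemma size_feasible W : feasible W ->
  (size W)%:R <= #|E|%:R * (max_cap I / min_dem I).
Proof.
case: W => [|[r0 p0] W'] fW.
  (* The bound must be nonnegative even over empty index types, where [sup] and [inf] are 0. *)
  rewrite mulr_ge0// divr_ge0//.
    have [e _|E0] := pickP (@predT E).
      by rewrite (le_trans (ltW (cap_gt0 e)))// sup_range_ge.
    rewrite /max_cap (_ : range _ = set0) ?sup0//.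
    by rewrite -subset0 => x [e]; have := E0 e.
  have [r _|E0] := pickP (@predT (request I)).
    by rewrite ltW// (inf_range_gt0 r)// => ?; exact: dem_gt0.
  rewrite /min_dem (_ : range _ = set0) ?inf0//.
  by rewrite -subset0 => x [e]; have := E0 e.
move: (_ :: W') fW => {p0}W [Wp Wc].
have d_gt0 : 0 < min_dem I by apply: (inf_range_gt0 r0) => ?; exact: dem_gt0.
rewrite mulrA ler_pdivlMr//.
have -> : (size W)%:R * min_dem I = \sum_(x <- W) min_dem I.
  by rewrite big_const_seq count_predT iter_addr_0 mulr_natl.
have -> : #|E|%:R * max_cap I = \sum_(e : E) max_cap I by rewrite sumr_const mulr_natl.
have : \sum_e load W e <= \sum_(e : E) max_cap I.
  by apply: ler_sum => e _; rewrite (le_trans (Wc e))// sup_range_ge.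
apply: le_trans; rewrite /load.
under [leRHS]eq_bigr do rewrite big_mkcond; rewrite exchange_big /=.
rewrite !big_seq; apply: ler_sum => x /Wp/req_path_neq0.
case: x.2 => [//|e p] _; rewrite (le_trans (min_dem_le x.1))//.
rewrite (bigD1 e)//= mem_head lerDl; apply: sumr_ge0 => f _.
by case: ifP => // _; exact: ltW (dem_gt0 _).
Qed.

(* Weak LP duality: y, scaled by the selected key, is feasible for the dual. *)
Lemma selected_duality eps W y r p S : reaches eps W y -> selected y r p ->
  feasible S -> dem r / worth r * plen y p * total_value S <= dual y.
Proof.
move=> Wy [_ minr] [Sp Sc]; have y_gt0 := reaches_gt0 Wy.
rewrite mulr_sumr.
(* The weighted load of [S] separates the two sides: capacities bound it from above, the minimal key
   bounds it from below pair by pair. *)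
apply: (@le_trans _ _ (\sum_e load S e * y e)); last first.
  by apply: ler_sum => e _; rewrite ler_pM2r.
under [leRHS]eq_bigr do rewrite /load big_mkcond mulr_suml; rewrite exchange_big /=.
rewrite !big_seq; apply: ler_sum => x /Sp xp.
(* The path in [S] need not be shortest, so minimality of the key is applied to a shortest path [q]
   of the same request. *)
have [q sq] := shortest_exists y_gt0 xp.
have w_gt0 := worth_gt0 x.1.
rewrite -ler_pdivlMr// (le_trans (minr _ _ sq))// mulrAC ler_pM2r ?invr_gt0//.
rewrite (@le_trans _ _ (dem x.1 * plen y x.2))//.
  by rewrite ler_pM2l ?dem_gt0//; case: sq => _; apply.
rewrite /plen big_uniq ?(req_path_uniq xp)//= mulr_sumr [leRHS](bigID (mem x.2))/=.
rewrite [X in _ <= _ + X]big1 ?addr0; last by move=> e /negbTE->; rewrite mul0r.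
by apply: ler_sum => e ->.
Qed.

(** From [1 - x <= expR (- x)] one gets [expR x <= 1 + x / (1 - x)], and [x <= d] bounds the
    denominator. *)
Lemma expR_le_inv (x d : R) : 0 <= x -> x <= d -> d < 1 ->
  expR x <= 1 + x / (1 - d).
Proof.
move=> x_ge0 xd d1.
have : expR x <= (1 - x)^-1.
  rewrite -[expR x]invrK -expRN lef_pV2 ?posrE ?expR_gt0//; last by lra.
  exact: expR_ge1Dx.
move=> /le_trans; apply.
have -> : (1 - x)^-1 = 1 + x / (1 - x) by field; lra.
rewrite lerD2l ler_wpM2l// lef_pV2 ?posrE; lra.
Qed.

(** As [B <= cap e] and demands are at most 1, each exponent is at most [eps], so [expR_le_inv]
    linearizes the update; the factor [cap e] cancels. *)
Lemma dual_update eps W y r p : 0 < eps -> eps < 1 ->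
  reaches eps W y -> req_path r p ->
  dual (update eps y r p) <= dual y + eps / (1 - eps) * B * (dem r * plen y p).
Proof.
move=> eps_gt0 eps_lt1 Wy rp; have y_gt0 := reaches_gt0 Wy.
rewrite /plen big_uniq ?(req_path_uniq rp)//= !mulr_sumr.
rewrite [X in _ + X]big_mkcond -big_split /=; apply: ler_sum => e _.
rewrite ffunE; case: ifP => _; last by rewrite addr0.
have c_gt0 := cap_gt0 e; have d_gt0 := dem_gt0 r; have d_le1 := dem_le1 r.
have Bc := min_cap_le e.
have B_gt0 : 0 < B by apply: (inf_range_gt0 e) => f; exact: cap_gt0.
have x_le : eps * B * dem r / cap e <= eps.
  by rewrite ler_pdivrMr// -mulrA ler_pM2l//; nra.
have x_ge0 : 0 <= eps * B * dem r / cap e.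
  by rewrite !mulr_ge0 ?invr_ge0 ?ltW.
have cy_ge0 : 0 <= cap e * y e by rewrite mulr_ge0// ltW.
have le_exp := ler_wpM2l cy_ge0 (expR_le_inv x_ge0 x_le eps_lt1).
rewrite mulrA (le_trans le_exp)// le_eqVlt; apply/orP; left; apply/eqP.
by field; rewrite !gt_eqF// subr_gt0.
Qed.

(** Initially the dual value is the number of edges. By duality an iteration multiplies it by at
    most [1 + k * worth r / total_value S], which is below the corresponding exponential. *)
Lemma dual_upper_bound eps W y S : 0 < eps -> eps < 1 ->
  feasible S -> 0 < total_value S -> reaches eps W y ->
  dual y <= #|E|%:R *
    expR (eps / (1 - eps) * B * total_value W / total_value S).
Proof.
move=> eps_gt0 eps_lt1 fS S_gt0; elim=> {W y} [|W y r p Wy IH gy sel].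
  rewrite /total_value big_nil mulr0 mul0r expR0 mulr1 /dual.
  under eq_bigr do rewrite ffunE divff ?gt_eqF ?cap_gt0//.
  by rewrite sumr_const.
have [[rp _] _] := sel.
have rpos := worth_gt0 r.
(* The selected path is nonempty and supplies an edge, which excludes a negative [B]. *)
have [B_ge0|B_lt0] := leP 0 B; last first.
  case: p rp {sel} => [/req_path_neq0//|e p _].
  have: 0 < B by apply: (inf_range_gt0 e) => f; exact: cap_gt0.
  by move=> /lt_trans/(_ B_lt0); rewrite ltxx.
apply: le_trans (dual_update eps_gt0 eps_lt1 Wy rp) _.
have dual_ge : dem r * plen y p <= worth r / total_value S * dual y.
  have := selected_duality Wy sel fS.
  rewrite -ler_pdivlMr// mulrAC ler_pdivrMr// => /le_trans; apply.
  by rewrite mulrC mulrA mulrAC.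
set k := eps / (1 - eps) * B.
have k_ge0 : 0 <= k by rewrite mulr_ge0// divr_ge0// ltW// subr_gt0.
have D_ge0 : 0 <= dual y.
  by apply: sumr_ge0 => e _; rewrite mulr_ge0 ?ltW ?cap_gt0 ?(reaches_gt0 Wy).
apply: (@le_trans _ _ (dual y * (1 + k * worth r / total_value S))).
  rewrite mulrDr mulr1 lerD2l; apply: le_trans (ler_wpM2l k_ge0 dual_ge) _.
  by rewrite le_eqVlt; apply/orP; left; apply/eqP; ring.
apply: le_trans (ler_wpM2l D_ge0 (expR_ge1Dx _)) _.
apply: le_trans (ler_wpM2r (expR_ge0 _) IH) _.
by rewrite -[leLHS]mulrA -expRD /total_value big_cons -mulrDl -mulrDr (addrC (worth _)).
Qed.

Lemma total_value_ge0 S : 0 <= total_value S.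
Proof. by apply: sumr_ge0 => x _; exact: ltW (worth_gt0 _). Qed.

Lemma outputs_approx eps W S : 0 < eps -> eps <= 1 -> (1 < #|E|)%N ->
  36 * (ln #|E|%:R / eps ^+ 2) <= B ->
  outputs (eps / 6%:R) W -> feasible S ->
  (1 + eps)^-1 * total_value S <= total_value W.
Proof.
move=> eps_gt0 eps_le1 m_gt1 le_B [y [Wy stop]] fS.
have W_ge0 := total_value_ge0 W.
rewrite ler_pdivrMl; last by lra.
have := total_value_ge0 S; rewrite le_eqVlt => /predU1P[<-|S_gt0].
  by rewrite mulr_ge0//; lra.
(* If nothing is routable, [S] is empty, contradicting its positive value; otherwise the guard has
   failed. *)
case: stop => [/negP|unroutable]; last first.
  have: S != [::] by apply: contraTneq S_gt0 => ->; rewrite /total_value big_nil ltxx.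
  case: S fS {S_gt0} => [//|[r p] S] [/(_ (r, p)) + _] _.
  by rewrite mem_head => /(_ isT) rp; case: unroutable; exists r, p.
rewrite -ltNge => big.
have d_gt0 : 0 < eps / 6%:R by lra.
have d_lt1 : eps / 6%:R < 1 by lra.
have := lt_le_trans big (dual_upper_bound d_gt0 d_lt1 fS S_gt0 Wy).
have m_gt0 : 0 < #|E|%:R :> R by rewrite ltr0n; lia.
rewrite -{1}[#|E|%:R]lnK ?posrE// -expRD ltr_expR.
set l := ln _; set t := total_value W / total_value S.
(* There are at least two edges, and [expR (1 / 2) <= 2]. *)
have l_ge : 1 / 2 <= l.
  have : expR (1/2) <= 2 :> R.
    have := @expR_le_inv (1/2) (1/2); have -> : 1/2 / (1 - 1/2) = 1 :> R by field.
    by move=> /(_ _ _ _)/le_trans; apply; lra.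
  rewrite -ler_ln ?posrE ?expR_gt0// expRK => /le_trans; apply.
  by rewrite ler_ln ?posrE// ler_nat.
have {le_B} : 36 * l <= B * eps ^+ 2.
  by rewrite -ler_pdivrMr ?exprn_gt0// -mulrA.
rewrite -(mulrA _ (total_value W)) -/t => le_B lt_t.
suff : 1 <= (1 + eps) * t by rewrite /t mulrA ler_pdivlMr// mul1r.
have t_ge0 : 0 <= t by rewrite divr_ge0// ltW.
(* With [d = eps / 6], [1 / (1 - d) = 1 + d / (1 - d)], and [1 - d >= 5 / 6]. *)
have kE : eps / 6%:R / (1 - eps / 6%:R) <= eps / 6%:R * (1 + eps / 5).
  rewrite ler_pdivrMr; last by lra.
  nra.
have B_gt0 : 0 < B.
  have : 0 < B * eps ^+ 2 by lra.
  by rewrite pmulr_lgt0// exprn_gt0.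
have : eps / 6%:R / (1 - eps / 6%:R) * B * t <= eps / 6%:R * (1 + eps / 5) * B * t.
  by rewrite ler_wpM2r// ler_wpM2r// ltW.
move: lt_t; set u := _ / (1 - _) * B * t => lt_t le_u.
have {u lt_t le_u} lt_t : eps / 6 * (B - 1) < l + eps / 6 * (1 + eps / 5) * B * t.
  by lra.
(* Both errors are small fractions of [B * (eps / 6)]: the logarithm costs [eps / 6] by the choice
   of 36, and the [- 1] of the guard costs [eps / 18], because [B * eps ^+ 2 >= 36 * l >= 18]. *)
have le_l : l <= eps / 6 * (B * (eps / 6)) by nra.
have le_1 : 1 <= B * (eps / 18) by nra.
have : B * (eps / 6) * (1 - eps / 18) <=  B * (eps / 6) * (eps / 6 + (1 + eps / 5) * t) by nra.
rewrite ler_pM2l; last by nra.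
(* Now [(1 + eps / 5) * t >= 1 - 2 * eps / 9], while [(1 + eps) * (1 - 2 * eps / 9) >= 1 + eps / 5]
   for [eps <= 1]. *)
move=> lt_t'; nra.
Qed.

End Approximation.

(** * Running time *)

Lemma tfold_cost_const (A S : Type) (f : S -> A -> timed S) (c : nat) :
  (forall s a, (f s a).2 <= c)%N ->
  forall l s, ((tfold f s l).2 <= size l * c.+1 + 2)%N.
Proof.
move=> cost l s; apply: (@tfold_cost _ _ f (fun=> 0%N) 0 c 0) => //.
Qed.

Section Costs.
Context {R : realType} {I : instance R}.
Local Notation E := (edge I).
Local Notation m := #|edge I|.
Local Notation B := (min_cap I).
Implicit Types (u v s : vertex I) (e : E) (p : seq E).
Implicit Types (L : seq (vertex I * label I)) (y : {ffun E -> R}).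

Lemma tlookup_cost v L : ((tlookup v L).2 <= 2 * size L + 2)%N.
Proof. by elim: L => [|[w a] L IH] //=; case: ifP => _ /=; lia. Qed.

Lemma tstore_cost v a L : ((tstore v a L).2 <= 3 * size L + 2)%N.
Proof. by elim: L => [|[w b] L IH] //=; case: ifP => _ /=; lia. Qed.

Lemma tstore_size v a L : (size (tstore v a L).1 <= size L + 1)%N.
Proof. by elim: L => [|[w b] L IH] //=; case: ifP => _ /=; lia. Qed.

Lemma trelax_cost y e u v L : ((trelax y e u v L).2 <= 7 * size L + 10)%N.
Proof.
rewrite /trelax /bind /=; have := tlookup_cost u L.
case: (tlookup u L).1 => [[d p]|] /=; last by lia.
have := tlookup_cost v L; have := tstore_cost v (d + y e, e :: p) L.
by case: (tlookup v L).1 => [[dv pv]|] /=; [case: ifP => _ /=|]; lia.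
Qed.

Lemma trelax_size y e u v L : (size (trelax y e u v L).1 <= size L + 1)%N.
Proof.
rewrite /trelax /bind /=.
case: (tlookup u L).1 => [[d p]|] /=; last by lia.
have := tstore_size v (d + y e, e :: p) L.
by case: (tlookup v L).1 => [[dv pv]|] //=; case: ifP => _ //=; lia.
Qed.

Lemma trelax_edge_cost y L e : ((trelax_edge y L e).2 <= 14 * size L + 30)%N.
Proof.
rewrite /trelax_edge /bind /=.
have := trelax_cost y e (esrc e) (edst e) L.
have := trelax_size y e (esrc e) (edst e) L.
have := trelax_cost y e (edst e) (esrc e) (trelax y e (esrc e) (edst e) L).1.
case: (directed I) => /=; lia.
Qed.

Lemma trelax_edge_size y L e : (size (trelax_edge y L e).1 <= size L + 2)%N.
Proof.
rewrite /trelax_edge /bind /=.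
have := trelax_size y e (esrc e) (edst e) L.
have := trelax_size y e (edst e) (esrc e) (trelax y e (esrc e) (edst e) L).1.
case: (directed I) => /=; lia.
Qed.

Lemma relax_round_size y L :
  (size (relax_round y L).1 <= size L + 2 * m)%N.
Proof.
rewrite cardE; apply: (tfold_size (mu := size)) => L' e.
exact: trelax_edge_size.
Qed.

(* Crude but sufficient: every relaxation of an edge inserts at most two labels. *)
Lemma tbellman_ford_size y s :
  (size (tbellman_ford y s).1 <= 1 + 2 * m * m)%N.
Proof.
rewrite /tbellman_ford /bind /= -/(relax_round y) [X in (_ * X)%N]cardE.
by apply: (tfold_size (mu := size)) => L' e; exact: relax_round_size.
Qed.

Lemma tbellman_ford_cost y s : (0 < m)%N ->
  ((tbellman_ford y s).2 <= 107 * m ^ 4)%N.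
Proof.
move=> m_gt0; rewrite /tbellman_ford /bind /= -/(relax_round y).
set M := (1 + 2 * m * m)%N.
have roundc L : (size L <= M)%N ->
    ((relax_round y L).2 <= m * (14 * (M + 2 * m) + 31) + 2)%N.
  move=> LM; pose c := (14 * (M + 2 * m) + 30)%N.
  have -> : (14 * (M + 2 * m) + 31 = c.+1)%N by rewrite /c; lia.
  rewrite [X in (X * _)%N]cardE.
  apply: (@tfold_cost _ _ _ size 2 _ (M + 2 * m)) => [L' e|L' e L'M|].
  - exact: trelax_edge_size.
  - by have := trelax_edge_cost y L' e; rewrite /c; lia.
  - by rewrite -cardE leq_add2r.
(* The table starts with one label and gains at most [2 * m] per round, so its size never exceeds
   [M]. *)
have := @tfold_cost E _ (fun L _ => relax_round y L) size (2 * m) _ M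
  (fun L _ => relax_round_size y L) (fun L _ => @roundc L)
  (enum E) [:: (s, (0, [::]))].
rewrite -cardE => /(_ (leqnn _)).
set t := (tfold _ _ _).2; rewrite /M => le_t.
have m2 : (m <= m ^ 2)%N by rewrite expnS expn1 leq_pmulr.
have m3 : (m ^ 2 <= m ^ 3)%N by rewrite leq_pexp2l.
have m4 : (m ^ 3 <= m ^ 4)%N by rewrite leq_pexp2l.
have : (t <= 28 * m ^ 4 + 28 * m ^ 3 + 45 * m ^ 2 + 3 * m + 2)%N.
  by apply: leq_trans le_t _; rewrite !expnS expn0; clear; move: #|_| => k; lia.
move: m_gt0 m2 m3 m4; clear; move: (m ^ 2)%N (m ^ 3)%N (m ^ 4)%N => a b c; lia.
Qed.

Lemma tselect_cost y : (0 < m)%N ->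
  ((tselect y).2 <= #|request I| * (120 * m ^ 4) + 2)%N.
Proof.
move=> m_gt0; have q_gt0 : (0 < m ^ 4)%N by rewrite expn_gt0 m_gt0.
(* Per request: [107 * m ^ 4] for Bellman-Ford, at most [8 * m ^ 4] for the lookup, and at most 4
   further steps. *)
rewrite cardE; apply: leq_trans (tfold_cost_const (c := 119 * m ^ 4) _ _ _) _.
  move=> b r; rewrite /bind /=.
  have := tbellman_ford_cost y (rsrc r) m_gt0.
  have := tlookup_cost (rtgt r) (tbellman_ford y (rsrc r)).1.
  have := tbellman_ford_size y (rsrc r).
  have m4 : (m * m <= m ^ 4)%N by rewrite mulnn leq_pexp2l.
  move: (m * m)%N (m ^ 4)%N (mulnA 2%N m m) m4 q_gt0 => m2 q.
  case: (tlookup _ _).1 => [[d p]|] /=; last by lia.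
  by case: b => [[[r1 k1] p1]|] /=; [case: ifP => _ /=|]; lia.
by rewrite -cardE leq_add2r leq_mul2l; apply/orP; right; lia.
Qed.

Lemma tupdate_cost eps b y r p :
  ((tupdate eps b y r p).2 <= 8 * size p + 2)%N.
Proof. by rewrite mulnC; apply: tfold_cost_const. Qed.

Lemma trev_cost p : ((trev p).2 <= 2 * size p + 2)%N.
Proof. by rewrite mulnC; apply: tfold_cost_const. Qed.

Lemma tsum_cost y : ((tsum y).2 <= 4 * m + 2)%N.
Proof. by rewrite mulnC cardE; apply: tfold_cost_const. Qed.

Lemma tmin_cap_cost : ((tmin_cap I).2 <= 3 * m + 3)%N.
Proof.
rewrite /tmin_cap /bind /= mulnC cardE addn1 addnS ltnS.
by apply: tfold_cost_const => -[x|] e //=; case: ifP.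
Qed.

Lemma tinit_cost : ((tinit I).2 <= 3 * m + 2)%N.
Proof. by rewrite mulnC cardE; apply: tfold_cost_const. Qed.

(** * Agreement of the implementation with the algorithm *)

Lemma trev_rev p : (trev p).1 = rev p.
Proof.
rewrite /trev tfold_foldl.
by elim/last_ind: p => // p e IH; rewrite foldl_rcons rev_rcons IH.
Qed.

Lemma tsum_dual y : (tsum y).1 = dual y.
Proof.
rewrite /dual -big_enum /tsum.
elim/(@tfold_ind E R): (enum _) / (tfold _ _ _).1; first by rewrite big_nil.
by move=> l x e; rewrite big_rcons /= => ->; rewrite addrC.
Qed.

Lemma tinit_weight : (tinit I).1 = init_weight I.
Proof.
suff H e : (tinit I).1 e = if e \in enum E then (cap e)^-1 else 0.
  by apply/ffunP => e; rewrite H mem_enum ffunE.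
rewrite /tinit.
elim/(@tfold_ind E {ffun E -> R}): (enum _) / (tfold _ _ _).1.
  by rewrite ffunE.
move=> l y f IH /=; rewrite /write ffunE IH mem_rcons in_cons.
by case: eqVneq => [->|].
Qed.

(** Distinct edges ensure that the in-place update multiplies each weight once. Order is irrelevant,
    so the reversed path serves. *)
Lemma tupdate_update eps b y r p q : b = B -> uniq p -> p =i q ->
  (tupdate eps b y r p).1 = update eps y r q.
Proof.
move=> -> up pq; apply/ffunP => e; rewrite ffunE -pq.
elim/last_ind: p up {pq} => [|p f IH]; first by [].
rewrite rcons_uniq => /andP[fp /IH {}IH].
rewrite /tupdate tfold_foldl foldl_rcons -tfold_foldl -/(tupdate eps B y r p).
rewrite /= /write ffunE mem_rcons in_cons; have [ef|_] := eqVneq; last exact: IH.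
by rewrite -ef IH ef (negbTE fp).
Qed.

Lemma tmin_cap_min : (0 < m)%N -> (tmin_cap I).1 = B.
Proof.
rewrite /tmin_cap /bind /= => /card_gt0P[e0 _].
pose best (l : seq E) (b : option R) :=
  if b is Some x then (exists e, x = cap e) /\ (forall e, e \in l -> x <= cap e)
  else l = [::].
suff : best (enum E) (tfold (fun (best : option R) (e : E) =>
    match best with
    | None => op (Some (cap e))
    | Some x =>
        let! b := op (cap e < x) in
        if b then op (Some (cap e)) else op best
    end) None (enum E)).1.
  case: (tfold _ _ _).1 => [x|] /=; last first.
    by move=> E0; have := mem_enum E e0; rewrite E0.
  case=> -[e ->] mine; symmetry; apply: inf_range_eq => f.
  by apply: mine; rewrite mem_enum.
elim/(@tfold_ind E (option R)): (enum _) / (tfold _ _ _).1; first by [].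
move=> l [x|] e /=; last first.
  by move=> ->; split=> [|f]; [exists e | rewrite inE => /eqP->].
case=> -[e1 ->] mine; case: ltP => le_e /=; split.
- by exists e.
- move=> f; rewrite mem_rcons in_cons => /predU1P[->//|/mine].
  by apply: le_trans; exact: ltW.
- by exists e1.
- by move=> f; rewrite mem_rcons in_cons => /predU1P[->//|/mine].
Qed.

Lemma tbody_cost eps W y : (0 < m)%N -> (forall e, 0 < y e) ->
  ((tbody eps B (W, y)).2 <= 200 * m ^ 4 * #|request I|.+1)%N.
Proof.
move=> m_gt0 y_gt0; rewrite /tbody /bind /=.
have m4 : (m <= m ^ 4)%N by rewrite -[leqLHS]expn1 leq_pexp2l.
have le_sum := tsum_cost y; have := tselect_cost y m_gt0.
rewrite -mulnA mulnS mulnCA (mulnC #|request I|).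
move: (m ^ 4)%N (m ^ 4 * #|request I|)%N m4 => q z m4 le_sel.
case: ifP => _ /=; last by lia.
have := tselect_correct y_gt0; move: le_sel.
case: (tselect y) => -[[[r k] p]|] t /= le_t; last by lia.
case=> -[/req_path_size + _] _; rewrite size_rev => p_le.
have := tupdate_cost eps B y r p; have := trev_cost p; lia.
Qed.

Lemma tbody_correct eps W y : reaches eps W y ->
  match (tbody eps B (W, y)).1 with
  | None => ~ guard eps y \/ ~ exists r p, req_path (I := I) r p
  | Some st => reaches eps st.1 st.2 /\ size st.1 = (size W).+1
  end.
Proof.
move=> Wy; have y_gt0 := reaches_gt0 Wy.
rewrite /tbody /bind /= tsum_dual.
case: ifP => [gy|/negP gy] /=; last by left.
have := tselect_correct y_gt0.
case: (tselect y).1 => [[[r k] p]|] /=; last by right.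
move=> sel; split=> //; rewrite trev_rev.
have up : uniq p by case: sel => -[/req_path_uniq + _] _; rewrite rev_uniq.
rewrite (@tupdate_update _ _ _ _ _ (rev p)) //; first exact: reaches_step.
by move=> e; rewrite mem_rev.
Qed.

(** Induction on the fuel [k], which exceeds the number of iterations left. The extra body in the
    bound on [T] is the final one, which exits. *)
Lemma loop_terminates eps (N : nat) : (0 < m)%N ->
  (forall W y, reaches (I := I) eps W y -> (size W <= N)%N) ->
  forall k W y, reaches eps W y -> (N < size W + k)%N ->
  exists T W' y', [/\ loop eps B (W, y) T (W', y'), outputs eps W',
    (size W <= size W')%N &
    (T <= (size W' - size W).+1 * (200 * m ^ 4 * #|request I|.+1))%N].
Proof.
move=> m_gt0 bounded; elim=> [|k IH] W y Wy.
  by have := bounded _ _ Wy; lia.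
move=> le_k; have := tbody_cost eps W m_gt0 (reaches_gt0 Wy).
set C := (200 * _ * _)%N in IH *.
have := tbody_correct Wy; case tb: (tbody eps B (W, y)) => [[[W1 y1]|] n] /=.
  move=> [/IH {}IH sW1 nC]; have [|T [W' [y' [lp out]]]] := IH; first by lia.
  rewrite sW1 => lt_W TC; exists (n + T)%N, W', y'; split=> //.
  - exact: loop_next tb lp.
  - exact: ltnW.
  - have -> : (size W' - size W = (size W' - (size W).+1).+1)%N by lia.
    by rewrite mulSn leq_add.
move=> stop nC; exists n, W, y; split=> //.
- exact: loop_exit.
- by exists y.
- by rewrite subnn mul1n.
Qed.

End Costs.

Theorem theorem7 (R : realType) :
  exists (c : R) (P : {poly {poly R}}), 0 < c /\
  forall (eps : R) (I : instance R),
    0 < eps -> eps <= 1 ->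
    (1 < #|edge I|)%N ->
    c * (ln (#|edge I|%:R) / eps ^+ 2) <= min_cap I ->
    [/\ (forall W : seq (request I * seq (edge I)),
           outputs (eps / 6%:R) W ->
           feasible W /\
           (forall S : seq (request I * seq (edge I)), feasible S ->
              (1 + eps)^-1 * total_value S <= total_value W)),
        (forall (W : seq (request I * seq (edge I))) (y : {ffun edge I -> R}),
           reaches (eps / 6%:R) W y ->
           (size W)%:R <=
             eval2 P (#|edge I|%:R) (max_cap I / min_dem I))
      & (exists (T : nat) (W : seq (request I * seq (edge I))),
           [/\ executes (eps / 6%:R) T W,
               outputs (eps / 6%:R) W
             & T%:R <= (#|request I|.+1)%:R *
                 eval2 P (#|edge I|%:R) (max_cap I / min_dem I)])].
Proof.
(* The outer variable stands for the number of edges, the inner one for the ratio. The factor 300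
   covers 200 per loop body and the initialization. *)
exists 36, (300%:R%:P%:P * 'X^4 * ('X * 'X%:P + 1)); split=> [//|eps I eps_gt0 eps_le1 m_gt1 le_B].
have eps6_gt0 : 0 < eps / 6%:R by rewrite divr_gt0.
set m := #|edge I|; set x := max_cap I / min_dem I.
have -> : eval2 (300%:R%:P%:P * 'X^4 * ('X * 'X%:P + 1)) m%:R x =
    300%:R * m%:R ^+ 4 * (m%:R * x + 1) :> R.
  by rewrite /eval2 !(hornerM, hornerD, hornerXn, hornerC, hornerX, horner_exp).
have size_le W y : reaches (I := I) (eps / 6%:R) W y -> (size W)%:R <= m%:R * x :> R.
    by move=> /(reaches_feasible eps6_gt0)/size_feasible.
(* The run with no iteration has size 0. *)
have mx_ge0 : 0 <= m%:R * x := size_le _ _ (reaches_init I (eps / 6%:R)).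
have m_ge1 : 1 <= m%:R :> R by rewrite ler1n; lia.
have m4_ge1 : 1 <= m%:R ^+ 4 :> R by rewrite exprn_ege1.
split.
- move=> W out; split; last by move=> S; apply: outputs_approx le_B out.
  by have [y [/(reaches_feasible eps6_gt0)]] := out.
- move=> W y /size_le /le_trans; apply; nra.
have m_gt0 : (0 < m)%N by lia.
(* An integer bound serves as fuel only; the cost estimate uses the real bound on [size W]. *)
pose N := Num.bound (m%:R * x).
have bounded W y : reaches (I := I) (eps / 6%:R) W y -> (size W <= N)%N.
  move=> /size_le sW; rewrite -(ler_nat R) (le_trans sW)// ltW//.
  by have := archi_boundP mx_ge0.
have [T [W [y [lp out _ le_T]]]] := loop_terminates m_gt0 bounded
  (reaches_init I (eps / 6%:R)) (ltnSn N).
exists ((tmin_cap I).2 + (tinit I).2 + T)%N, W; split=> //.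
  by exists T, y; rewrite tmin_cap_min// tinit_weight.
have le_W : (size W)%:R <= m%:R * x by have [y1 [/size_le]] := out.
have := tmin_cap_cost (I := I); have := tinit_cost (I := I).
move: le_T; rewrite subn0 -/m.
move: (tmin_cap I).2 (tinit I).2 #|request I| => a b rho.
have m4 : (m <= m ^ 4)%N by rewrite -[leqLHS]expn1 leq_pexp2l.
move=> le_T le_b le_a.
have : (a + b + T <= rho.+1 * (300 * m ^ 4 * (size W + 1)))%N by nia.
rewrite -(ler_nat R) => /le_trans; apply.
by rewrite !(natrX, natrD, natrM) ler_wpM2l// ler_wpM2l// lerD2r.
Qed.
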